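(* Let $a_0,b_0,c_0,a_1,b_2$ be functions of $t$, put $b_1=t+b_2^2-c_0$, $c_1=-b_2$, and consider the operator $z\frac{d}{dz}+A$ with $$A=\begin{pmatrix} 0 & 1 \\ 0 & 0 \end{pmatrix}z^3+\begin{pmatrix} 0 & b_2 \\ 1 & 0 \end{pmatrix}z^2+\begin{pmatrix} a_1 & b_1 \\ c_1 & -a_1 \end{pmatrix}z+\begin{pmatrix} a_0 & b_0 \\ c_0 & -a_0 \end{pmatrix}.$$ Suppose (Lax pair condition) that this operator commutes with an operator $$\frac{d}{dt}+\begin{pmatrix} y_1 & y_2 \\ y_3 & -y_1 \end{pmatrix}+z\begin{pmatrix} y_4 & y_5 \\ y_6 & -y_4 \end{pmatrix},$$ where $y_1,\dots,y_6$ are functions of $t$, and that $p_0:=a_0^2+b_0c_0$ satisfies $\frac{dp_0}{dt}=0$. This eliminates $y_1,\dots,y_6$ and produces the equations (with $'=\frac{d}{dt}$) $$a_0'=2b_2c_0-b_0,\quad b_0'=-4a_0b_2,\quad a_1'=-3b_2^2+2c_0-t,\quad b_2'=-2a_1,\quad c_0'=2a_0.$$ For $c_0=0$, and also for a fixed residue matrix at $z=0$ (i.e., $a_0'=b_0'=c_0'=0$), one obtains the first Painlevé equation $P_1$. For $c_0\neq 0$, eliminating $b_0=(p_0-a_0^2)/c_0$ gives the Painlevé type vector field $$a_0'=2b_2c_0-\frac{p_0-a_0^2}{c_0},\quad c_0'=2a_0,\quad a_1'=-3b_2^2+2c_0-t,\quad b_2'=-2a_1.$$ Here $a_1=-\frac12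 b_2'$, $c_0=\frac t2+\frac32 b_2^2-\frac14 b_2''$, $a_0=\frac14+\frac32 b_2b_2'-\frac18 b_2^{(3)}$, and the remaining equation is the following fourth-order explicit differential equation for $f:=b_2$, with $f^{(j)}=(\frac{d}{dt})^jf$: $$\begin{aligned} -2\big(6f^2-f^{(2)}+2t\big)f^{(4)}={}&288f^5-240f^3f^{(2)}+192tf^3-24ff^{(1)}f^{(3)}+32f\big(f^{(2)}\big)^2-80tff^{(2)}+32ft^2 \\ &+24\big(f^{(1)}\big)^2f^{(2)}-48t\big(f^{(1)}\big)^2+48ff^{(1)}+\big(f^{(3)}\big)^2-4f^{(3)}-64p_0+4.\end{aligned}$$
   Context: The operators $z\frac{d}{dz}+A$ form the universal family of rank 2 connections over $\mathbb{C}(z)$ with trivial determinant, with a regular singularity at $z=0$, and with generalized eigenvalues $\pm(z^{5/2}+\frac t2z^{1/2})$ at $z=\infty$; the relations $c_1=-b_2$ and $t=b_1-b_2^2+c_0$ express the condition at $\infty$. This is the standard family for $P_1$, except that a regular singularity is allowed at $z=0$. The matrix $\begin{pmatrix} a_0 & b_0\\ c_0&-a_0\end{pmatrix}$ is the residue matrix at $z=0$, and $p_0$ is the basic parameter, independent of $t$ in an isomonodromic family.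
   Formalization: The two commuting operators are taken to act on row vectors (u ↦ z u_z + uA, u ↦ u_t + uB); with the usual action on columns the displayed equations would hold with a_0, a_1 replaced by −a_0, −a_1. *)

(* Defs.v *)
From HB Require Import structures.
From mathcomp Require Import all_boot all_order all_algebra.
From mathcomp Require Import complex.
From mathcomp Require Import all_classical all_reals all_analysis.
Set Implicit Arguments.
Unset Strict Implicit.
Unset Printing Implicit Defensive.
Import Order.TTheory GRing.Theory Num.Theory.
Import numFieldNormedType.Exports.
Local Open Scope ring_scope.
Local Open Scope classical_set_scope.

(* The field of complex numbers over a model R of the reals, as a numFieldType:
   the topology, derivable and derive1 below are those induced by the complex
   modulus, so that derivatives are complex derivatives. *)
Definition Cplx (R : realType) : numFieldType := R[i].

Section Operators.
Variables (R : realType).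
Local Notation C := (Cplx R).

(* Functions of t are functions holomorphic on a fixed open set U; their values
   outside U are irrelevant. *)
Definition holo (V : normedModType C) (U : set C) (f : C -> V) : Prop :=
  forall t, U t -> derivable f t 1.

Definition mx2 (a b c d : C) : 'M[C]_2 :=
  \matrix_(i, j) if i == 0 then (if j == 0 then a else b)
                 else (if j == 0 then c else d).

(* A(z,t), with b_1 = t + b_2^2 - c_0 and c_1 = - b_2 substituted. *)
Definition matA (a0 b0 c0 a1 b2 : C -> C) (z t : C) : 'M[C]_2 :=
  let b1 := t + b2 t ^+ 2 - c0 t in
  let c1 := - b2 t in
  z ^+ 3 *: mx2 0 1 0 0
  + z ^+ 2 *: mx2 0 (b2 t) 1 0
  + z *: mx2 (a1 t) b1 c1 (- a1 t)
  + mx2 (a0 t) (b0 t) (c0 t) (- a0 t).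

Definition matB (y1 y2 y3 y4 y5 y6 : C -> C) (z t : C) : 'M[C]_2 :=
  mx2 (y1 t) (y2 t) (y3 t) (- y1 t) + z *: mx2 (y4 t) (y5 t) (y6 t) (- y4 t).

(* The operators z d/dz + A and d/dt + B, acting on row vectors u(z,t):
   A and B are connection matrices with respect to a basis (e_1, e_2) in the
   convention nabla e_i = \sum_j A_ij e_j.  For this convention the vanishing of
   the commutator is dA/dt = z dB/dz - [A, B]; the action on columns would
   reverse the sign of [A, B], and change a_0, a_1 into - a_0, - a_1 in the
   resulting differential equations. *)
Definition op_z (A : C -> C -> 'M[C]_2) (u : C -> C -> 'rV[C]_2) :
    C -> C -> 'rV[C]_2 :=
  fun z t => z *: derive1 (fun w => u w t) z + u z t *m A z t.

Definition op_t (B : C -> C -> 'M[C]_2) (u : C -> C -> 'rV[C]_2) :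
    C -> C -> 'rV[C]_2 :=
  fun z t => derive1 (fun s => u z s) t + u z t *m B z t.

(* The vector functions the operators are applied to: polynomials in z whose
   coefficients are holomorphic functions of t.  The commutator of op_z A and
   op_t B is multiplication by a matrix, so that its vanishing is already
   detected on constant vectors. *)
Definition poly_section (U : set C) (u : C -> C -> 'rV[C]_2) : Prop :=
  exists (n : nat) (v : nat -> C -> 'rV[C]_2),
    (forall k, holo U (v k)) /\
    u = (fun z t => \sum_(k < n) z ^+ k *: v k t).

Definition commute_on (U : set C) (A B : C -> C -> 'M[C]_2) : Prop :=
  forall u, poly_section U u ->
  forall z t, U t -> op_z A (op_t B u) z t = op_t B (op_z A u) z t.

Definition lax_pair (U : set C) (a0 b0 c0 a1 b2 : C -> C) : Prop :=
  exists y1 y2 y3 y4 y5 y6 : C -> C,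
    [/\ [/\ holo U y1, holo U y2 & holo U y3],
        [/\ holo U y4, holo U y5 & holo U y6] &
        commute_on U (matA a0 b0 c0 a1 b2) (matB y1 y2 y3 y4 y5 y6)].

Definition deriv0_on (U : set C) (f : C -> C) : Prop :=
  forall t, U t -> derive1 f t = 0.

Definition isomonodromy_system (U : set C) (a0 b0 c0 a1 b2 : C -> C) : Prop :=
  forall t, U t ->
    [/\ derive1 a0 t = 2 * b2 t * c0 t - b0 t,
        derive1 b0 t = - 4 * a0 t * b2 t,
        derive1 a1 t = - 3 * b2 t ^+ 2 + 2 * c0 t - t,
        derive1 b2 t = - 2 * a1 t
      & derive1 c0 t = 2 * a0 t].

Definition painleve_field (U : set C) (p0 a0 c0 a1 b2 : C -> C) : Prop :=
  forall t, U t ->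
    [/\ derive1 a0 t = 2 * b2 t * c0 t - (p0 t - a0 t ^+ 2) / c0 t,
        derive1 c0 t = 2 * a0 t,
        derive1 a1 t = - 3 * b2 t ^+ 2 + 2 * c0 t - t
      & derive1 b2 t = - 2 * a1 t].

(* The standard normalization y'' = 6 y^2 + s; the equation f'' = 6 f^2 + 2 t
   takes this form for y(s) = mu^2 f(mu s) when 2 mu^5 = 1. *)
Definition painleve1 (U : set C) (y : C -> C) : Prop :=
  forall s, U s -> derive1n 2 y s = 6 * y s ^+ 2 + s.

Definition fourth_order_eq (U : set C) (p0 f : C -> C) : Prop :=
  forall t, U t ->
    - 2 * (6 * f t ^+ 2 - derive1n 2 f t + 2 * t) * derive1n 4 f t =
      288 * f t ^+ 5 - 240 * f t ^+ 3 * derive1n 2 f t + 192 * t * f t ^+ 3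
      - 24 * f t * derive1n 1 f t * derive1n 3 f t + 32 * f t * derive1n 2 f t ^+ 2
      - 80 * t * f t * derive1n 2 f t + 32 * f t * t ^+ 2
      + 24 * derive1n 1 f t ^+ 2 * derive1n 2 f t - 48 * t * derive1n 1 f t ^+ 2
      + 48 * f t * derive1n 1 f t + derive1n 3 f t ^+ 2 - 4 * derive1n 3 f t
      - 64 * p0 t + 4.

End Operators.

(* Main.v *)
Require Import Defs.
From HB Require Import structures.
From mathcomp Require Import all_boot all_order all_algebra.
From mathcomp Require Import complex.
From mathcomp Require Import all_classical all_reals all_analysis.
From mathcomp Require Import ring.
Set Implicit Arguments.
Unset Strict Implicit.
Unset Printing Implicit Defensive.
Import Order.TTheory GRing.Theory Num.Theory.
Import numFieldNormedType.Exports.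
Local Open Scope ring_scope.
Local Open Scope classical_set_scope.

(* On polynomial sections the commutator of the two operators is multiplication
   by z dB/dz + BA - AB - dA/dt, so commutation is the vanishing of this matrix.
   Comparing coefficients of z in its entries forces y1 = y4 = y6 = 0,
   y3 = y5 and y2 = 2 b2 y3; the normalization b1 = t + b2^2 - c0 then gives
   y3 = 1, and the remaining coefficients are the isomonodromy equations.
   The other equivalences are eliminations.  Only derivatives that the system
   expresses through the given holomorphic functions are differentiated again,
   so Cauchy's theorem (holomorphic implies infinitely differentiable) plays no
   role. *)

(** * Differentiation rules for functions of one variable with values in a normed space *)

Section DerivativeRules.
Context {K : numFieldType}.
Implicit Types (x t : K) (f g : K -> K).

Lemma derive1_is_derive {V : normedModType K} (f : K -> V) x (df : V) :
  is_derive x 1 f df -> derive1 f x = df.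
Proof. by move=> fx; rewrite derive1E derive_val. Qed.

Lemma is_derive_derive1 {V : normedModType K} (f : K -> V) x :
  derivable f x 1 -> is_derive x 1 f (derive1 f x).
Proof. by move=> fx; rewrite derive1E; apply: derivableP. Qed.

Lemma is_derive_cst_fun {V : normedModType K} (a : V) x :
  is_derive x 1 (fun=> a) 0.
Proof. exact: is_derive_cst. Qed.

Lemma is_derive_id_fun x : is_derive x 1 (fun s : K => s) 1.
Proof. exact: is_derive_id. Qed.

Lemma is_derive_add {V : normedModType K} (f g : K -> V) x df dg :
  is_derive x 1 f df -> is_derive x 1 g dg ->
  is_derive x 1 (fun s => f s + g s) (df + dg).
Proof. exact: is_deriveD. Qed.

Lemma is_derive_opp {V : normedModType K} (f : K -> V) x df :
  is_derive x 1 f df -> is_derive x 1 (fun s => - f s) (- df).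
Proof. exact: is_deriveN. Qed.

Lemma is_derive_sum_fun {V : normedModType K} n (h : 'I_n -> K -> V) x dh :
  (forall i, is_derive x 1 (h i) (dh i)) ->
  is_derive x 1 (fun s => \sum_(i < n) h i s) (\sum_(i < n) dh i).
Proof.
move=> hx; have := is_derive_sum hx.
by congr is_derive; apply/funext => s; rewrite fct_sumE.
Qed.

Lemma is_derive_mul f g x df dg :
  is_derive x 1 f df -> is_derive x 1 g dg ->
  is_derive x 1 (fun s => f s * g s) (df * g x + f x * dg).
Proof.
move=> fx gx; have fgx := is_deriveM fx gx.
by apply: (is_derive_eq fgx); rewrite /GRing.scale/= addrC mulrC.
Qed.

Lemma is_derive_mull c f x df :
  is_derive x 1 f df -> is_derive x 1 (fun s => c * f s) (c * df).
Proof. exact: is_deriveZ. Qed.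

Lemma is_derive_exp f n x df :
  is_derive x 1 f df ->
  is_derive x 1 (fun s => f s ^+ n) (n%:R * f x ^+ n.-1 * df).
Proof. by move=> fx; have := is_deriveX n fx; rewrite exprfctE. Qed.

Lemma is_derive_scalel {V : normedModType K} f (v : V) x df :
  is_derive x 1 f df -> is_derive x 1 (fun s => f s *: v) (df *: v).
Proof.
move=> fx.
have dfx : differentiable f x by apply/derivable1_diffP; case: fx.
split; first by apply/derivable1_diffP; apply: differentiableZl.
have /derive1_is_derive <- := fx.
rewrite deriveE ?diffZl//; last exact: differentiableZl.
by rewrite -deriveE// derive1E.
Qed.

(** The chain rule for an inner dilation, used to rescale to the normalized first Painleve
    equation. *)
Lemma is_derive_mulr_arg {V : normedModType K} (f : K -> V) (c : K) x df :
  is_derive (c * x) 1 f df -> is_derive x 1 (fun s => f (c * s)) (c *: df).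
Proof.
move=> fx.
have dfx : differentiable f (c * x) by apply/derivable1_diffP; case: fx.
have dc : is_diff x (fun s : K => c * s) (fun s : K => c * s).
  exact: is_diff_scaler.
have dc1 : differentiable (fun s : K => c * s) x by case: dc.
have dcE : 'd (fun s : K => c * s) x = (fun s : K => c * s) :> (K -> K).
  by case: dc.
split; first by apply/derivable1_diffP; apply: (differentiable_comp dc1 dfx).
rewrite deriveE; last exact: (differentiable_comp dc1 dfx).
rewrite (diff_comp dc1 dfx) dcE/=.
rewrite -[c * 1]/(c *: (1 : K^o)) linearZ/= -deriveE// -derive1E.
by rewrite (derive1_is_derive fx).
Qed.

(** From right to left, a matrix function is a finite sum of its entries times the constants
    [delta_mx i j]. From left to right, reading off an entry is a continuous linear map, so the
    chain rule applies. *)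
Lemma is_derive_mxP m n (M : K -> 'M[K]_(m, n)) x (dM : 'M[K]_(m, n)) :
  is_derive x 1 M dM <->
  forall i j, is_derive x 1 (fun s => M s i j) (dM i j).
Proof.
split=> [Mx i j|Mx]; last first.
  have -> : M = fun s => \sum_i \sum_j M s i j *: delta_mx i j.
    by apply/funext => s; exact: matrix_sum_delta.
  rewrite [dM]matrix_sum_delta.
  apply: is_derive_sum_fun => i; apply: is_derive_sum_fun => j.
  exact: is_derive_scalel.
(* The entry map is packed as a linear map, so that [diff_lin] identifies its differential with
   itself. *)
have clin : linear (fun N : 'M[K]_(m, n) => N i j).
  by move=> a N P; rewrite !mxE.
pose cM := GRing.isLinear.Build _ _ _ _ _ clin.
pose c : {linear 'M[K]_(m, n) -> K} := HB.pack (fun N : 'M[K]_(m, n) => N i j) cM.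
have cc : continuous c by exact: coord_continuous.
have dMx : differentiable M x by apply/derivable1_diffP; case: Mx.
have dc : differentiable c (M x) by exact: linear_differentiable.
split; first by apply/derivable1_diffP; apply: (differentiable_comp dMx dc).
rewrite deriveE; last exact: (differentiable_comp dMx dc).
rewrite (diff_comp dMx dc) (diff_lin _ cc)/= -deriveE// -derive1E.
by rewrite (derive1_is_derive Mx).
Qed.

(** Derivatives are local, so an identity known only on [U] may be differentiated at the points of
    [U]. *)
Lemma is_derive_on_open {V : normedModType K} (U : set K) (f g : K -> V) x df :
  open U -> (forall s, U s -> f s = g s) -> U x ->
  is_derive x 1 f df -> is_derive x 1 g df.
Proof.
move=> oU fg Ux; apply: near_eq_is_derive.
by near=> s; apply: fg; near: s; apply: open_nbhs_nbhs.
Unshelve. all: by end_near. Qed.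

Lemma is_derive_mulmx m n p (M : K -> 'M[K]_(m, n)) (N : K -> 'M[K]_(n, p))
    x dM dN :
  is_derive x 1 M dM -> is_derive x 1 N dN ->
  is_derive x 1 (fun s => M s *m N s) (dM *m N x + M x *m dN).
Proof.
move=> /is_derive_mxP Mx /is_derive_mxP Nx; apply/is_derive_mxP => i j.
under eq_fun do rewrite mxE.
rewrite !mxE -big_split/=; apply: is_derive_sum_fun => k.
exact: is_derive_mul.
Qed.

Lemma is_derive_scale {V : normedModType K} (v : K -> V) c x dv :
  is_derive x 1 v dv -> is_derive x 1 (fun s => c *: v s) (c *: dv).
Proof. exact: is_deriveZ. Qed.

End DerivativeRules.

(** * The commutator of the two operators as multiplication by a curvature matrix *)

Section ZeroCurvature.
Context {R : realType}.
Local Notation C := (Cplx R).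
Variables (U : set C) (A B At Bz : C -> C -> 'M[C]_2).
Hypothesis dA : forall z t : C, U t -> is_derive t 1 (fun s => A z s) (At z t).
Hypothesis dB : forall z t : C, U t -> is_derive z 1 (fun w => B w t) (Bz z t).

(** By the Leibniz rule both compositions contain the same terms in the derivatives of [u]. A single
    [uzt] serves as both mixed derivatives, so their symmetry is part of the hypotheses. *)
Lemma op_commutator (u : C -> C -> 'rV[C]_2) (ut uz : C -> 'rV[C]_2)
    (uzt : 'rV[C]_2) (z t : C) : U t ->
  (forall w, is_derive t 1 (u w) (ut w)) ->
  (forall s, is_derive z 1 (u ^~ s) (uz s)) ->
  is_derive z 1 ut uzt -> is_derive t 1 uz uzt ->
  op_z A (op_t B u) z t - op_t B (op_z A u) z t =
  u z t *m (z *: Bz z t + B z t *m A z t - A z t *m B z t - At z t).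
Proof.
move=> Ut dut duz dutz duzt.
have op_tE : op_t B u ^~ t = fun w => ut w + u w t *m B w t.
  by apply/funext => w; rewrite /op_t (derive1_is_derive (dut w)).
have op_zE : op_z A u z = fun s => z *: uz s + u z s *m A z s.
  by apply/funext => s; rewrite /op_z (derive1_is_derive (duz s)).
have -> : op_z A (op_t B u) z t =
    z *: (uzt + (uz t *m B z t + u z t *m Bz z t)) +
    (ut z + u z t *m B z t) *m A z t.
  rewrite [LHS]/op_z -[op_t B u z t]/((op_t B u ^~ t) z) op_tE.
  congr (_ *: _ + _); apply: derive1_is_derive.
  exact: (is_derive_add dutz (is_derive_mulmx (duz t) (dB z Ut))).
have -> : op_t B (op_z A u) z t =
    z *: uzt + (ut z *m A z t + u z t *m At z t) +
    (z *: uz t + u z t *m A z t) *m B z t.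
  rewrite [LHS]/op_t op_zE; congr (_ + _); apply: derive1_is_derive.
  exact: (is_derive_add (is_derive_scale z duzt)
            (is_derive_mulmx (dut z) (dA z Ut))).
rewrite !mulmxBr !mulmxDr !mulmxDl !scalerDr -!mulmxA -!scalemxAl -!scalemxAr.
rewrite !opprD !addrA.
(* The permutation pairs the terms in [uzt], [uz] and [ut] with their opposites; the four terms in
   [u z t] remain. *)
by rewrite [LHS](ACl (1*6*(2*9)*(4*7)*3*5*10*8))/= !subrr !add0r.
Qed.

Lemma poly_section_op_commutator (u : C -> C -> 'rV[C]_2) (z t : C) :
  poly_section U u -> U t ->
  op_z A (op_t B u) z t - op_t B (op_z A u) z t =
  u z t *m (z *: Bz z t + B z t *m A z t - A z t *m B z t - At z t).
Proof.
move=> [n [v [hv ->]]] Ut.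
have dv k : is_derive t 1 (v k) (derive1 (v k) t).
  by apply: is_derive_derive1; apply: hv.
(* Termwise differentiation of the polynomial. For k = 0 the factor [k%:R] is zero, so the truncated
   exponent [k.-1] is harmless. *)
apply: (@op_commutator _
    (fun w => \sum_(k < n) w ^+ k *: derive1 (v k) t)
    (fun s => \sum_(k < n) (k%:R * z ^+ k.-1 * 1) *: v k s)
    (\sum_(k < n) (k%:R * z ^+ k.-1 * 1) *: derive1 (v k) t)) => //.
- by move=> w; apply: is_derive_sum_fun => k; apply: is_derive_scale.
- move=> s; apply: is_derive_sum_fun => k; apply: is_derive_scalel.
  exact: (is_derive_exp k (is_derive_id_fun z)).
- apply: is_derive_sum_fun => k; apply: is_derive_scalel.
  exact: (is_derive_exp k (is_derive_id_fun z)).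
- by apply: is_derive_sum_fun => k; apply: is_derive_scale.
Qed.

Lemma commute_onP :
  commute_on U A B <->
  forall z t, U t -> At z t = z *: Bz z t + B z t *m A z t - A z t *m B z t.
Proof.
split=> [comm z t Ut|flat u hu z t Ut]; last first.
  by apply/eqP; rewrite -subr_eq0 poly_section_op_commutator// flat// subrr mulmx0.
apply/eqP; rewrite eq_sym -subr_eq0; apply/eqP/row_matrixP => i.
rewrite row0 rowE.
(* A constant basis vector is a polynomial section of length 1, and multiplying by it extracts row i
   of the curvature matrix. *)
have hu : poly_section U (fun _ _ : C => delta_mx 0 i : 'rV[C]_2).
  exists 1%N, (fun _ _ => delta_mx 0 i); split.
    by move=> k s _; apply: derivable_cst.
  by apply/funext => w; apply/funext => s; rewrite big_ord1 expr0 scale1r.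
by rewrite -(poly_section_op_commutator z hu Ut) comm// subrr.
Qed.

End ZeroCurvature.

Lemma eq_of_subr_eq0 (V : zmodType) (x y e : V) : x - y = e -> e = 0 -> x = y.
Proof. by move=> xye e0; apply/eqP; rewrite -subr_eq0 xye e0. Qed.

(** * Comparison of the coefficients of z at a fixed time *)

Section LaxAlgebra.
Context {K : numFieldType}.
Implicit Types (q y z : K).

(** The values at 0, 1, -1, 2, -2 suffice: combinations of them isolate 24 q4, 12 q3, and then 2 q1
    and 2 q2, and these integers are invertible in characteristic zero. *)
Lemma quartic_eq0 q0 q1 q2 q3 q4 :
  (forall z, q0 + q1 * z + q2 * z ^+ 2 + q3 * z ^+ 3 + q4 * z ^+ 4 = 0) ->
  [/\ q0 = 0, q1 = 0, q2 = 0, q3 = 0 & q4 = 0].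
Proof.
pose F z := q0 + q1 * z + q2 * z ^+ 2 + q3 * z ^+ 3 + q4 * z ^+ 4.
move=> F0; have {}F0 z : F z = 0 by exact: F0.
have cancel n (x : K) : n.+1%:R * x = 0 -> x = 0.
  by move/eqP; rewrite mulf_eq0 pnatr_eq0/= => /eqP.
have q00 : q0 = 0 by rewrite -(F0 0) /F; ring.
have q40 : q4 = 0.
  (* The fourth central difference of F is 24 q4; [cancel n] removes the factor n + 1. *)
  apply: (cancel 23%N).
  transitivity (F 2 + F (-2) - 4 * (F 1 + F (-1)) + 6 * F 0).
    by rewrite /F; ring.
  by rewrite !F0; ring.
have q30 : q3 = 0.
  apply: (cancel 11%N); transitivity (F 2 - F (-2) - 2 * (F 1 - F (-1))).
    by rewrite /F; ring.
  by rewrite !F0; ring.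
split=> //.
- apply: (cancel 1%N); transitivity (F 1 - F (-1)).
    by rewrite /F q30; ring.
  by rewrite !F0 subrr.
- apply: (cancel 1%N); transitivity (F 1 + F (-1)).
    by rewrite /F q00 q40; ring.
  by rewrite !F0 addr0.
Qed.

(** Functions and their time derivatives are replaced by independent scalars, which makes the
    elimination pure algebra. The entries of A are [alpha], [beta], [gamma], and those of B are [p],
    [q], [r]. *)
Variables (a0 b0 c0 a1 b2 t da0 db0 dc0 da1 db2 y1 y2 y3 y4 y5 y6 : K).
Let b1 := t + b2 ^+ 2 - c0.
Let db1 := 1 + 2 * b2 * db2 - dc0.
Let alpha z := z * a1 + a0.
Let beta z := z ^+ 3 + z ^+ 2 * b2 + z * b1 + b0.
Let gamma z := z ^+ 2 - z * b2 + c0.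
Let p z := y1 + z * y4.
Let q z := y2 + z * y5.
Let r z := y3 + z * y6.

Lemma zero_curvature_coefs :
  (forall z,
    [/\ z * da1 + da0 = z * y4 + q z * gamma z - beta z * r z,
        z ^+ 2 * db2 + z * db1 + db0 =
          z * y5 + 2 * (p z * beta z - alpha z * q z) &
        - (z * db2) + dc0 = z * y6 + 2 * (alpha z * r z - gamma z * p z)]) ->
  [/\ da0 = 2 * b2 * c0 - b0, db0 = - 4 * a0 * b2,
      da1 = - 3 * b2 ^+ 2 + 2 * c0 - t, db2 = - 2 * a1 & dc0 = 2 * a0].
Proof.
move=> E.
have two : (2 : K) != 0 by rewrite pnatr_eq0.
(* The arguments are the coefficients of 1, z, ..., z^4 in the difference of the two sides of the
   upper left entry. The next two applications treat the upper right and lower left entries. *)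
have [] := @quartic_eq0 (da0 + b0 * y3 - c0 * y2)
  (da1 - y4 + b1 * y3 + b0 * y6 + b2 * y2 - c0 * y5)
  (b2 * y3 + b1 * y6 - y2 + b2 * y5) (y3 + b2 * y6 - y5) y6.
  move=> z; have [e _ _] := E z; move: e.
  by move=> /eqP; rewrite -subr_eq0 => /eqP e; rewrite -[RHS]e /beta /gamma /q /r; ring.
move=> A0 A1 A2 A3 y60.
have [] := @quartic_eq0 (db0 + 2 * a0 * y2 - 2 * b0 * y1)
  (db1 - y5 + 2 * (a1 * y2 + a0 * y5) - 2 * b1 * y1 - 2 * b0 * y4)
  (db2 + 2 * a1 * y5 - 2 * b2 * y1 - 2 * b1 * y4)
  (- 2 * y1 - 2 * b2 * y4) (- 2 * y4).
  move=> z; have [_ e _] := E z; move: e.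
  by move=> /eqP; rewrite -subr_eq0 => /eqP e; rewrite -[RHS]e /alpha /beta /p /q; ring.
move=> B0 B1 B2 B3 /eqP; rewrite mulf_eq0 oppr_eq0 (negPf two)/= => /eqP y40.
(* This entry has degree at most 3 in z, hence the final 0. *)
have [] := @quartic_eq0 (dc0 + 2 * c0 * y1 - 2 * a0 * y3)
  (- db2 - y6 + 2 * (c0 * y4 - b2 * y1) - 2 * (a1 * y3 + a0 * y6))
  (2 * (y1 - b2 * y4) - 2 * a1 * y6) (2 * y4) 0.
  move=> z; have [_ _ e] := E z; move: e.
  by move=> /eqP; rewrite -subr_eq0 => /eqP e; rewrite -[RHS]e /alpha /gamma /p /r; ring.
move=> C0 C1 _ _ _.
move: B3; rewrite y40 mulr0 subr0 => /eqP.
rewrite mulf_eq0 oppr_eq0 (negPf two)/= => /eqP y10.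
have y53 : y5 = y3.
  by apply/esym; apply: (eq_of_subr_eq0 _ A3); rewrite y60; ring.
move: A0 A1 A2 B0 B1 B2 C0 C1; rewrite y10 y40 y53 y60 => A0 A1 A2 B0 B1 B2 C0 C1.
have y2E : y2 = 2 * b2 * y3.
  by apply/esym; apply: (eq_of_subr_eq0 _ A2); ring.
move: A0 A1 B0 B1; rewrite y2E => A0 A1 B0 B1.
have db2E : db2 = - 2 * a1 * y3 by apply: (eq_of_subr_eq0 _ B2); ring.
have dc0E : dc0 = 2 * a0 * y3 by apply: (eq_of_subr_eq0 _ C0); ring.
(* In the z coefficient of the upper right entry, the terms in a0 and in a1 b2 cancel. What remains
   is 1 - y3, where 1 is the derivative of the explicit t in b1. *)
have y31 : y3 = 1.
  apply/esym; apply: (eq_of_subr_eq0 _ B1); rewrite /db1 db2E dc0E; ring.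
rewrite y31 in A0 A1 B0 db2E dc0E; split.
- by apply: (eq_of_subr_eq0 _ A0); ring.
- by apply: (eq_of_subr_eq0 _ B0); ring.
- by apply: (eq_of_subr_eq0 _ A1); rewrite /b1; ring.
- by rewrite db2E mulr1.
- by rewrite dc0E mulr1.
Qed.

End LaxAlgebra.

(** * Successive derivatives of b2 *)

Section IteratedDerivatives.
Context {K : numFieldType}.
Variables (U : set K) (f : K -> K).
Hypotheses (oU : open U) (df : forall t, U t -> derivable f t 1).

(** In the applications of this and the next two lemmas [f] is b2, and the auxiliary function is a1,
    c0 and a0 in turn. Each derivative of [f] equals on [U] an expression that is known to be
    differentiable. *)
Lemma derive1n2_eq (a : K -> K) :
  (forall t, U t -> derivable a t 1) ->
  (forall t, U t -> derive1 f t = - 2 * a t) -> forall t, U t ->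
  derivable (derive1 f) t 1 /\ derive1n 2 f t = - 2 * derive1 a t.
Proof.
move=> da fa t Ut.
have fat : is_derive t 1 (derive1 f) (- 2 * derive1 a t).
  apply: (is_derive_on_open oU _ Ut (is_derive_mull _ (is_derive_derive1 (da t Ut)))).
  by move=> s Us; rewrite fa.
by split; [case: fat | exact: derive1_is_derive].
Qed.

Lemma derive1n3_eq (c : K -> K) :
  (forall t, U t -> derivable c t 1) ->
  (forall t, U t -> derive1n 2 f t = 6 * f t ^+ 2 + 2 * t - 4 * c t) ->
  forall t, U t ->
  derive1n 3 f t = 12 * f t * derive1 f t + 2 - 4 * derive1 c t.
Proof.
move=> dc fc t Ut.
have ft := is_derive_derive1 (df Ut); have ct := is_derive_derive1 (dc t Ut).
have fct := is_derive_add (is_derive_add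
  (is_derive_mull 6 (is_derive_exp 2 ft)) (is_derive_mull 2 (is_derive_id_fun t)))
  (is_derive_opp (is_derive_mull 4 ct)).
rewrite derive1nS (derive1_is_derive (is_derive_on_open oU _ Ut fct)).
  by rewrite /=; ring.
by move=> s Us; rewrite fc.
Qed.

Lemma derive1n4_eq (a : K -> K) :
  (forall t, U t -> derivable a t 1) ->
  (forall t, U t -> derivable (derive1 f) t 1) ->
  (forall t, U t -> derive1n 3 f t = 12 * f t * derive1 f t + 2 - 8 * a t) ->
  forall t, U t ->
  derive1n 4 f t =
    12 * derive1 f t ^+ 2 + 12 * f t * derive1n 2 f t - 8 * derive1 a t.
Proof.
move=> da ddf fa t Ut.
have ft := is_derive_derive1 (df Ut); have aat := is_derive_derive1 (da t Ut).
have fft := is_derive_derive1 (ddf t Ut).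
have fat := is_derive_add (is_derive_add
  (is_derive_mull 12 (is_derive_mul ft fft)) (is_derive_cst_fun (2 : K) t))
  (is_derive_opp (is_derive_mull 8 aat)).
rewrite derive1nS (derive1_is_derive (is_derive_on_open oU _ Ut fat)).
  by rewrite /=; ring.
by move=> s Us; rewrite fa// mulrA.
Qed.

End IteratedDerivatives.

(** * Calculus of explicit two by two matrices *)

Section Mx2.
Context {R : realType}.
Local Notation C := (Cplx R).

Lemma mx2P (M N : 'M[C]_2) :
  M = N <-> [/\ M 0 0 = N 0 0, M 0 1 = N 0 1, M 1 0 = N 1 0 & M 1 1 = N 1 1].
Proof.
split=> [-> //|[e00 e01 e10 e11]]; apply/matrixP => i j.
have ord2 (k : 'I_2) : k = 0 \/ k = 1.
  by case: k => [[|[|k]] kP]; [left|right|]; try exact: val_inj.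
by case: (ord2 i) => ->; case: (ord2 j) => ->.
Qed.

Lemma mx2_inj (a b c d a' b' c' d' : C) :
  mx2 a b c d = mx2 a' b' c' d' -> [/\ a = a', b = b', c = c' & d = d'].
Proof. by move=> /mx2P; rewrite !mxE. Qed.

Lemma mx2D (a b c d a' b' c' d' : C) :
  mx2 a b c d + mx2 a' b' c' d' = mx2 (a + a') (b + b') (c + c') (d + d').
Proof. by apply/mx2P; rewrite !mxE. Qed.

Lemma mx2N (a b c d : C) : - mx2 a b c d = mx2 (- a) (- b) (- c) (- d).
Proof. by apply/mx2P; rewrite !mxE. Qed.

Lemma mx2Z (k a b c d : C) : k *: mx2 a b c d = mx2 (k * a) (k * b) (k * c) (k * d).
Proof. by apply/mx2P; rewrite !mxE. Qed.

Lemma mx2M (a b c d a' b' c' d' : C) :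
  mx2 a b c d *m mx2 a' b' c' d' =
  mx2 (a * a' + b * c') (a * b' + b * d') (c * a' + d * c') (c * b' + d * d').
Proof. by apply/mx2P; rewrite !mxE !big_ord_recl !big_ord0 !mxE/= !addr0. Qed.

Lemma is_derive_mx2 (a b c d : C -> C) (x da db dc dd : C) :
  is_derive x 1 a da -> is_derive x 1 b db -> is_derive x 1 c dc ->
  is_derive x 1 d dd ->
  is_derive x 1 (fun s => mx2 (a s) (b s) (c s) (d s)) (mx2 da db dc dd).
Proof.
move=> ax bx cx dx; apply/is_derive_mxP => i j; under eq_fun do rewrite mxE.
by rewrite mxE; case: (i == 0); case: (j == 0).
Qed.

End Mx2.

(** * Equivalence of the Lax pair condition with the isomonodromy system *)

Section LaxPair.
Context {R : realType}.
Local Notation C := (Cplx R).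
Variables (U : set C) (a0 b0 c0 a1 b2 : C -> C).
Hypotheses (ha0 : holo U a0) (hb0 : holo U b0) (hc0 : holo U c0)
  (ha1 : holo U a1) (hb2 : holo U b2).

Let dt_matA (z t : C) : 'M[C]_2 :=
  let db1 := 1 + 2 * b2 t * derive1 b2 t - derive1 c0 t in
  mx2 (z * derive1 a1 t + derive1 a0 t)
      (z ^+ 2 * derive1 b2 t + z * db1 + derive1 b0 t)
      (- (z * derive1 b2 t) + derive1 c0 t)
      (- (z * derive1 a1 t + derive1 a0 t)).

Lemma matAE (z t : C) :
  matA a0 b0 c0 a1 b2 z t =
  mx2 (z * a1 t + a0 t)
      (z ^+ 3 + z ^+ 2 * b2 t + z * (t + b2 t ^+ 2 - c0 t) + b0 t)
      (z ^+ 2 - z * b2 t + c0 t) (- (z * a1 t + a0 t)).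
Proof. by rewrite /matA !mx2Z !mx2D; congr mx2; ring. Qed.

Lemma matBE (y1 y2 y3 y4 y5 y6 : C -> C) (z t : C) :
  matB y1 y2 y3 y4 y5 y6 z t =
  mx2 (y1 t + z * y4 t) (y2 t + z * y5 t) (y3 t + z * y6 t)
      (- (y1 t + z * y4 t)).
Proof. by rewrite /matB !mx2Z !mx2D; congr mx2; ring. Qed.

Lemma is_derive_matA (z t : C) : U t ->
  is_derive t 1 (matA a0 b0 c0 a1 b2 z) (dt_matA z t).
Proof.
(* [matA] agrees everywhere with its entrywise form, which is the one differentiated. *)
move=> Ut; apply: (is_derive_on_open openT (fun s _ => esym (matAE z s)) I).
have da0 := is_derive_derive1 (ha0 Ut); have db0 := is_derive_derive1 (hb0 Ut).
have dc0 := is_derive_derive1 (hc0 Ut); have da1 := is_derive_derive1 (ha1 Ut).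
have db2 := is_derive_derive1 (hb2 Ut).
have da := is_derive_add (is_derive_mull z da1) da0.
have db := is_derive_add (is_derive_add (is_derive_add
    (is_derive_cst_fun (z ^+ 3) t) (is_derive_mull (z ^+ 2) db2))
    (is_derive_mull z (is_derive_add (is_derive_add (is_derive_id_fun t)
      (is_derive_exp 2 db2)) (is_derive_opp dc0)))) db0.
have dc := is_derive_add (is_derive_add (is_derive_cst_fun (z ^+ 2) t)
    (is_derive_opp (is_derive_mull z db2))) dc0.
apply: (is_derive_eq (is_derive_mx2 da db dc (is_derive_opp da))).
rewrite /dt_matA.
(* Over R[i] the conversion tests of ring do not terminate on derivatives. *)
move: (derive1 a0 t) (derive1 b0 t) (derive1 c0 t) (derive1 a1 t) (derive1 b2 t).
by move=> *; congr mx2; rewrite /=; ring.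
Qed.

Lemma is_derive_matB (y1 y2 y3 y4 y5 y6 : C -> C) (z t : C) :
  is_derive z 1 ((matB y1 y2 y3 y4 y5 y6) ^~ t)
    (mx2 (y4 t) (y5 t) (y6 t) (- y4 t)).
Proof.
rewrite /matB; have dB := is_derive_add
  (is_derive_cst_fun (mx2 (y1 t) (y2 t) (y3 t) (- y1 t)) z)
  (is_derive_scalel (mx2 (y4 t) (y5 t) (y6 t) (- y4 t)) (is_derive_id_fun z)).
by apply: (is_derive_eq dB); rewrite add0r scale1r.
Qed.

(** Both sides of the matrix equation have trace zero, so the lower right entry repeats the upper
    left one and three scalar equations remain. *)
Lemma lax_pair_curvature (y1 y2 y3 y4 y5 y6 : C -> C) :
  commute_on U (matA a0 b0 c0 a1 b2) (matB y1 y2 y3 y4 y5 y6) <->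
  forall z t, U t ->
  let alpha := z * a1 t + a0 t in
  let beta := z ^+ 3 + z ^+ 2 * b2 t + z * (t + b2 t ^+ 2 - c0 t) + b0 t in
  let gamma := z ^+ 2 - z * b2 t + c0 t in
  let p := y1 t + z * y4 t in
  let q := y2 t + z * y5 t in
  let r := y3 t + z * y6 t in
  [/\ z * derive1 a1 t + derive1 a0 t = z * y4 t + q * gamma - beta * r,
      z ^+ 2 * derive1 b2 t +
        z * (1 + 2 * b2 t * derive1 b2 t - derive1 c0 t) + derive1 b0 t =
        z * y5 t + 2 * (p * beta - alpha * q) &
      - (z * derive1 b2 t) + derive1 c0 t =
        z * y6 t + 2 * (alpha * r - gamma * p)].
Proof.
have curv := @commute_onP _ U (matA a0 b0 c0 a1 b2) (matB y1 y2 y3 y4 y5 y6)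
  dt_matA (fun _ t => mx2 (y4 t) (y5 t) (y6 t) (- y4 t))
  is_derive_matA (fun z t _ => is_derive_matB y1 y2 y3 y4 y5 y6 z t).
apply: (iff_trans curv).
split=> flat z t Ut; have := flat z t Ut.
  rewrite matAE matBE mx2Z !mx2M mx2N !mx2D.
  move=> /mx2_inj [e1 e2 e3 _]; split.
  - by apply: (etrans e1); ring.
  - by apply: (etrans e2); ring.
  - by apply: (etrans e3); ring.
move=> [e1 e2 e3]; rewrite matAE matBE mx2Z !mx2M mx2N !mx2D; congr mx2.
- by apply: (etrans e1); ring.
- by apply: (etrans e2); ring.
- by apply: (etrans e3); ring.
- by apply: (etrans (congr1 -%R e1)); ring.
Qed.

Lemma isomonodromy_lax_pair :
  lax_pair U a0 b0 c0 a1 b2 <-> isomonodromy_system U a0 b0 c0 a1 b2.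
Proof.
split=> [[y1 [y2 [y3 [y4 [y5 [y6 [_ _]]]]]]] /lax_pair_curvature flat t Ut|iso].
  exact: (zero_curvature_coefs (fun z => flat z t Ut)).
have hcst (k : C) : holo U (fun=> k) by move=> t _; exact: derivable_cst.
(* These are the values that [zero_curvature_coefs] forces. *)
exists (fun=> 0), (fun s => 2 * b2 s), (fun=> 1), (fun=> 0), (fun=> 1), (fun=> 0).
split; [split | split; exact: hcst | ]; first exact: hcst.
- by move=> t Ut; case: (is_derive_mull 2 (is_derive_derive1 (hb2 Ut))).
- exact: hcst.
apply/lax_pair_curvature => z t Ut; move: (iso t Ut).
move: (derive1 a0 t) (derive1 b0 t) (derive1 c0 t) (derive1 a1 t) (derive1 b2 t).
by move=> da0 db0 dc0 da1 db2 [-> -> -> -> ->]; split; ring.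
Qed.

(** The function is minus the determinant of the residue matrix. Its derivative is 2 a0 (2 b2 c0 -
    b0) - 4 a0 b2 c0 + 2 a0 b0 = 0. *)
Lemma isomonodromy_residue_det (t : C) :
  isomonodromy_system U a0 b0 c0 a1 b2 -> U t ->
  derive1 (fun s => a0 s ^+ 2 + b0 s * c0 s) t = 0.
Proof.
move=> iso Ut; have := is_derive_add
  (is_derive_exp 2 (is_derive_derive1 (ha0 Ut)))
  (is_derive_mul (is_derive_derive1 (hb0 Ut)) (is_derive_derive1 (hc0 Ut))).
move=> /derive1_is_derive ->; move: (iso t Ut).
move: (derive1 a0 t) (derive1 b0 t) (derive1 c0 t) => da0 db0 dc0.
by move=> [-> -> _ _ ->]; rewrite /=; ring.
Qed.

End LaxPair.

(** * Rescaling and elimination identities *)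

Section Elimination.
Context {K : numFieldType}.

Lemma derive1_eq0_on_open (U : set K) (f : K -> K) : open U ->
  (forall t, U t -> f t = 0) -> forall t, U t -> derive1 f t = 0.
Proof.
move=> oU f0 t Ut; apply: derive1_is_derive.
apply: (is_derive_on_open oU _ Ut (is_derive_cst_fun (0 : K) t)).
by move=> s Us; rewrite f0.
Qed.

(** Differentiating twice brings out mu^2, so the right side is 6 mu^4 f^2 + 2 mu^5 s, and the
    choice of mu makes the coefficient of s equal to 1. *)
Lemma painleve1_rescaling (U : set K) (f : K -> K) (mu : K) : open U ->
  2 * mu ^+ 5 = 1 ->
  (forall t, U t -> derivable f t 1) ->
  (forall t, U t -> derivable (derive1 f) t 1) ->
  (forall t, U t -> derive1n 2 f t = 6 * f t ^+ 2 + 2 * t) ->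
  forall s, U (mu * s) ->
  derive1n 2 (fun s => mu ^+ 2 * f (mu * s)) s =
    6 * (mu ^+ 2 * f (mu * s)) ^+ 2 + s.
Proof.
move=> oU mu5 df ddf f2 s Us.
have oV : open [set s | U (mu * s)].
  apply: (@open_comp _ _ (fun s => mu * s)) => // x _.
  apply/differentiable_continuous/derivable1_diffP.
  by case: (is_derive_mull mu (is_derive_id_fun x)).
have dg x : U (mu * x) -> is_derive x 1 (fun s => mu ^+ 2 * f (mu * s))
    (mu ^+ 2 * (mu * derive1 f (mu * x))).
  move=> Ux; apply: is_derive_mull; apply: is_derive_mulr_arg.
  exact/is_derive_derive1/df.
have ddg : is_derive s 1 (fun s => mu ^+ 2 * (mu * derive1 f (mu * s)))
    (mu ^+ 2 * (mu * (mu * derive1 (derive1 f) (mu * s)))).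
  apply: is_derive_mull; apply: is_derive_mull; apply: is_derive_mulr_arg.
  exact/is_derive_derive1/ddf.
rewrite derive1nS (derive1_is_derive (is_derive_on_open oV _ Us ddg)).
  rewrite -[derive1 (derive1 f) _]/(derive1n 2 f _) f2//.
  have -> : 6 * (mu ^+ 2 * f (mu * s)) ^+ 2 + s =
    6 * (mu ^+ 2 * f (mu * s)) ^+ 2 + (2 * mu ^+ 5) * s by rewrite mu5 mul1r.
  by ring.
by move=> x Ux; rewrite derive1n1 (derive1_is_derive (dg _ Ux)).
Qed.

(* Differentiating b0 = 2 b2 c0 gives a1 c0 = 0; differentiating that twice,
   using that c0 is constant, leaves c0 = 0. *)
Lemma constant_residue_c0_eq0 (U : set K) (b0 c0 a1 b2 : K -> K) : open U ->
  (forall t, U t -> [/\ derivable c0 t 1, derivable a1 t 1 & derivable b2 t 1]) ->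
  (forall t, U t -> b0 t = 2 * b2 t * c0 t) ->
  (forall t, U t -> derive1 b0 t = 0) -> (forall t, U t -> derive1 c0 t = 0) ->
  (forall t, U t -> derive1 b2 t = - 2 * a1 t) ->
  (forall t, U t -> derive1 a1 t = - 3 * b2 t ^+ 2 + 2 * c0 t - t) ->
  forall t, U t -> c0 t = 0.
Proof.
move=> oU reg b0E db0 dc0 db2 da1.
have dc s : U s -> is_derive s 1 c0 0.
  by move=> Us; rewrite -(dc0 s Us); apply: is_derive_derive1; case: (reg s Us).
have da s : U s -> is_derive s 1 a1 (- 3 * b2 s ^+ 2 + 2 * c0 s - s).
  by move=> Us; rewrite -(da1 s Us); apply: is_derive_derive1; case: (reg s Us).
have db s : U s -> is_derive s 1 b2 (- 2 * a1 s).
  by move=> Us; rewrite -(db2 s Us); apply: is_derive_derive1; case: (reg s Us).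
have a1c0 s : U s -> a1 s * c0 s = 0.
  move=> Us.
  have d := is_derive_on_open oU (fun s Us => esym (b0E s Us)) Us
    (is_derive_mul (is_derive_mull 2 (db s Us)) (dc s Us)).
  have := db0 s Us; rewrite (derive1_is_derive d).
  rewrite mulr0 addr0 => /eqP; rewrite mulrA -mulrA mulf_eq0 => /orP[/eqP h|/eqP//].
  by exfalso; move/eqP: h; rewrite mulf_eq0 oppr_eq0 !pnatr_eq0.
have da1c0 s : U s -> (- 3 * b2 s ^+ 2 + 2 * c0 s - s) * c0 s = 0.
  move=> Us; have d := is_derive_mul (da s Us) (dc s Us).
  by have := derive1_eq0_on_open oU a1c0 Us; rewrite (derive1_is_derive d) mulr0 addr0.
move=> t Ut.
have d := is_derive_mul (is_derive_add (is_derive_add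
  (is_derive_mull (- 3) (is_derive_exp 2 (db t Ut)))
  (is_derive_mull 2 (dc t Ut))) (is_derive_opp (is_derive_id_fun t))) (dc t Ut).
have := derive1_eq0_on_open oU da1c0 Ut; rewrite (derive1_is_derive d) => e.
have := a1c0 t Ut => ac.
(* The derivative of -3 b2^2 is 12 a1 b2, so [e] reads (12 a1 b2 - 1) c0 = 0. Substituting it for
   the 0 gives back c0. *)
transitivity (12 * b2 t * (a1 t * c0 t) - 0); last by rewrite ac; ring.
by rewrite -[in RHS]e /=; ring.
Qed.

Lemma is_derive_residue_det (U : set K) (a0 b0 c0 p0 : K -> K) t : open U -> U t ->
  derivable a0 t 1 -> derivable b0 t 1 -> derivable c0 t 1 ->
  (forall t, U t -> p0 t = a0 t ^+ 2 + b0 t * c0 t) ->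
  derive1 p0 t =
    2 * a0 t * derive1 a0 t + (derive1 b0 t * c0 t + b0 t * derive1 c0 t).
Proof.
move=> oU Ut da0 db0 dc0 p0E; apply: derive1_is_derive.
have d := is_derive_add (is_derive_exp 2 (is_derive_derive1 da0))
  (is_derive_mul (is_derive_derive1 db0) (is_derive_derive1 dc0)).
by have := is_derive_on_open oU (fun s Us => esym (p0E s Us)) Ut d.
Qed.

Lemma residue_b0E (p a b c : K) : c != 0 ->
  p = a ^+ 2 + b * c <-> b = (p - a ^+ 2) / c.
Proof.
by move=> c0; split=> ->; [rewrite [a ^+ 2 + _]addrC addrK mulfK|rewrite divfK// subrKC].
Qed.

Lemma mulN2_half (a d : K) : d = - 2 * a <-> a = - (1 / 2) * d.
Proof. by split=> ->; field. Qed.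

Lemma second_derivative_c0E (c f2 f t : K) :
  f2 = 6 * f ^+ 2 + 2 * t - 4 * c <-> c = t / 2 + 3 / 2 * f ^+ 2 - 1 / 4 * f2.
Proof. by split=> ->; field. Qed.

Lemma third_derivative_a0E (a f f1 f3 : K) :
  f3 = 12 * f * f1 + 2 - 8 * a <-> a = 1 / 4 + 3 / 2 * f * f1 - 1 / 8 * f3.
Proof. by split=> ->; field. Qed.

(** Since 6 f^2 - f2 + 2 t = 4 c and f4 contains -8 da, the left side contains 64 c da. The
    fourth-order equation is thus the equation for a0' multiplied by 64 c, a nonzero factor. *)
Lemma fourth_order_elimination (t p a c da f f1 f2 f3 f4 : K) : c != 0 ->
  f2 = 6 * f ^+ 2 + 2 * t - 4 * c ->
  f3 = 12 * f * f1 + 2 - 8 * a ->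
  f4 = 12 * f1 ^+ 2 + 12 * f * f2 - 8 * da ->
  da = 2 * f * c - (p - a ^+ 2) / c <->
  - 2 * (6 * f ^+ 2 - f2 + 2 * t) * f4 =
    288 * f ^+ 5 - 240 * f ^+ 3 * f2 + 192 * t * f ^+ 3
    - 24 * f * f1 * f3 + 32 * f * f2 ^+ 2
    - 80 * t * f * f2 + 32 * f * t ^+ 2
    + 24 * f1 ^+ 2 * f2 - 48 * t * f1 ^+ 2
    + 48 * f * f1 + f3 ^+ 2 - 4 * f3
    - 64 * p + 4.
Proof.
move=> c0 f2E f3E f4E.
set lhs := (X in _ <-> X = _); set rhs := (X in _ <-> _ = X).
have key : lhs - rhs = 64 * c * (da - (2 * f * c - (p - a ^+ 2) / c)).
  by rewrite /lhs /rhs f4E f3E f2E; field.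
split=> [dE|/eqP]; first by apply/eqP; rewrite -subr_eq0 key dE subrr mulr0.
rewrite -subr_eq0 key mulf_eq0 mulf_eq0 (negPf c0) pnatr_eq0/= subr_eq0.
by move/eqP.
Qed.

End Elimination.

(** * Reduction to the first Painleve equation and to the fourth-order equation *)

Section Painleve.
Context {R : realType}.
Local Notation C := (Cplx R).
Variables (U : set C) (oU : open U) (a0 b0 c0 a1 b2 : C -> C).
Hypotheses (ha0 : holo U a0) (hb0 : holo U b0) (hc0 : holo U c0)
  (ha1 : holo U a1) (hb2 : holo U b2).

(** The common right side of the two equivalences about the first Painleve equation. *)
Definition reduces_to_P1 (mu : C) :=
  [/\ (forall t, U t -> [/\ a0 t = 0, b0 t = 0 & c0 t = 0]),
      (forall t, U t -> a1 t = - (1 / 2) * derive1 b2 t),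
      (forall t, U t -> derive1n 2 b2 t = 6 * b2 t ^+ 2 + 2 * t)
    & painleve1 [set s | U (mu * s)] (fun s => mu ^+ 2 * b2 (mu * s))].

(** If c0 vanishes, then c0' = 2 a0 gives a0 = 0, and a0' = 2 b2 c0 - b0 gives b0 = 0. The two
    remaining equations combine into b2'' = 6 b2^2 + 2 t. *)
Lemma isomonodromy_c0_eq0 (mu : C) : 2 * mu ^+ 5 = 1 ->
  isomonodromy_system U a0 b0 c0 a1 b2 -> (forall t, U t -> c0 t = 0) ->
  reduces_to_P1 mu.
Proof.
move=> mu5 iso c00.
have a00 t : U t -> a0 t = 0.
  move=> Ut; have [_ _ _ _ e] := iso t Ut; move/eqP: e.
  rewrite (derive1_eq0_on_open oU c00 Ut) eq_sym mulf_eq0 pnatr_eq0/=.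
  by move/eqP.
have b00 t : U t -> b0 t = 0.
  move=> Ut; have [e _ _ _ _] := iso t Ut; move: e.
  rewrite (derive1_eq0_on_open oU a00 Ut) c00// mulr0 sub0r.
  by move/esym/eqP; rewrite oppr_eq0 => /eqP.
have db2 t : U t -> derive1 b2 t = - 2 * a1 t by move=> Ut; case: (iso t Ut).
have b2'' t : U t -> derive1n 2 b2 t = 6 * b2 t ^+ 2 + 2 * t.
  move=> Ut; have [_ e2] := derive1n2_eq oU ha1 db2 Ut.
  apply: (etrans e2); have [_ _ e _ _] := iso t Ut.
  by apply: (etrans (congr1 ( *%R (- 2)) e)); rewrite c00//; ring.
split=> [t Ut|t Ut|//|s Us].
- by split; [exact: a00 | exact: b00 | exact: c00].
- exact/mulN2_half/db2.
- have db2' t : U t -> derivable (derive1 b2) t 1.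
    by move=> Ut; have [] := derive1n2_eq oU ha1 db2 Ut.
  exact: (painleve1_rescaling oU mu5 hb2 db2' b2'' Us).
Qed.

(** The residue equations reduce to 0 = 0. The equation for a1' follows by equating -2 a1' with the
    given value of b2''. *)
Lemma reduces_to_P1_isomonodromy (mu : C) : reduces_to_P1 mu ->
  [/\ isomonodromy_system U a0 b0 c0 a1 b2, deriv0_on U a0, deriv0_on U b0,
      deriv0_on U c0 & forall t, U t -> c0 t = 0].
Proof.
move=> [z0 a1E b2'' _].
have a00 t : U t -> a0 t = 0 by move=> /z0[].
have b00 t : U t -> b0 t = 0 by move=> /z0[].
have c00 t : U t -> c0 t = 0 by move=> /z0[].
have db2 t : U t -> derive1 b2 t = - 2 * a1 t.
  by move=> Ut; apply/mulN2_half/a1E.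
have da0 := derive1_eq0_on_open oU a00.
have db0 := derive1_eq0_on_open oU b00.
have dc0 := derive1_eq0_on_open oU c00.
suff iso : isomonodromy_system U a0 b0 c0 a1 b2.
  exact: And5 iso da0 db0 dc0 c00.
move=> t Ut; split.
- by rewrite (da0 t Ut) (b00 t Ut) (c00 t Ut) mulr0 subr0.
- by rewrite (db0 t Ut) (a00 t Ut) mulr0 mul0r.
- have [_ e2] := derive1n2_eq oU ha1 db2 Ut.
  have /mulN2_half e1 := etrans (esym (b2'' t Ut)) e2.
  by apply: (etrans e1); rewrite (c00 t Ut); field.
- exact: db2.
- by rewrite (dc0 t Ut) (a00 t Ut) mulr0.
Qed.

Lemma isomonodromy_P1 (mu : C) : 2 * mu ^+ 5 = 1 ->
  (isomonodromy_system U a0 b0 c0 a1 b2 /\ (forall t, U t -> c0 t = 0)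
     <-> reduces_to_P1 mu) /\
  (isomonodromy_system U a0 b0 c0 a1 b2 /\
     [/\ deriv0_on U a0, deriv0_on U b0 & deriv0_on U c0]
     <-> reduces_to_P1 mu).
Proof.
move=> mu5; split; split.
- by move=> [iso c00]; exact: isomonodromy_c0_eq0.
- by move=> /reduces_to_P1_isomonodromy[iso _ _ _ c00]; exact: conj.
- move=> [iso [da0 db0 dc0]]; apply: (isomonodromy_c0_eq0 mu5 iso).
  have reg t : U t -> [/\ derivable c0 t 1, derivable a1 t 1 & derivable b2 t 1].
    by move=> Ut; exact: And3 (hc0 Ut) (ha1 Ut) (hb2 Ut).
  (* Constancy of a0 turns its evolution equation into this algebraic relation. *)
  have b0E t : U t -> b0 t = 2 * b2 t * c0 t.
    move=> Ut; have [e _ _ _ _] := iso t Ut.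
    by apply/esym; apply: (eq_of_subr_eq0 (esym e)); exact: da0.
  have db2 t : U t -> derive1 b2 t = - 2 * a1 t by case/iso.
  have da1 t : U t -> derive1 a1 t = - 3 * b2 t ^+ 2 + 2 * c0 t - t by case/iso.
  exact: (constant_residue_c0_eq0 oU reg b0E db0 dc0 db2 da1).
- move=> /reduces_to_P1_isomonodromy[iso da0 db0 dc0 _].
  exact: conj iso (And3 da0 db0 dc0).
Qed.

(** The equation for b0' is absent from the vector field. It is recovered by differentiating p0 =
    a0^2 + b0 c0: constancy of p0 gives c0 b0' = -4 a0 b2 c0, and c0 cancels. *)
Lemma isomonodromy_painleve_field (p0 : C -> C) : deriv0_on U p0 ->
  (forall t, U t -> c0 t != 0) ->
  isomonodromy_system U a0 b0 c0 a1 b2 /\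
    (forall t, U t -> p0 t = a0 t ^+ 2 + b0 t * c0 t)
  <-> painleve_field U p0 a0 c0 a1 b2 /\
    (forall t, U t -> b0 t = (p0 t - a0 t ^+ 2) / c0 t).
Proof.
move=> dp0 c0N0; split=> [[iso p0E]|[pf b0E]].
  have b0E t : U t -> b0 t = (p0 t - a0 t ^+ 2) / c0 t.
    by move=> Ut; apply/residue_b0E; [exact: c0N0|exact: p0E].
  split; last exact: b0E.
  move=> t Ut; have [e1 _ e3 e4 e5] := iso t Ut.
  exact: And4 (etrans e1 (congr1 (fun x => 2 * b2 t * c0 t - x) (b0E t Ut))) e5 e3 e4.
have p0E t : U t -> p0 t = a0 t ^+ 2 + b0 t * c0 t.
  by move=> Ut; apply/residue_b0E; [exact: c0N0|exact: b0E].
split; last exact: p0E.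
move=> t Ut; have [e1 e2 e3 e4] := pf t Ut.
have {}e1 := etrans e1 (congr1 (fun x => 2 * b2 t * c0 t - x) (esym (b0E t Ut))).
suff e5 : derive1 b0 t = - 4 * a0 t * b2 t by exact: And5 e1 e5 e3 e4 e2.
have := is_derive_residue_det oU Ut (ha0 Ut) (hb0 Ut) (hc0 Ut) p0E.
move: e1 e2 (dp0 t Ut) (c0N0 t Ut).
move: (derive1 a0 t) (derive1 b0 t) (derive1 c0 t) (derive1 p0 t).
move=> da0 db0 dc0 dp -> -> -> c0tN0 e.
by apply: (mulIf c0tN0); apply: (eq_of_subr_eq0 _ (esym e)); ring.
Qed.

(** The formulas for a1, c0 and a0 are the first three derivatives of b2 solved for these functions;
    the fourth derivative brings in a0', whose equation becomes the fourth-order one. *)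
Lemma painleve_field_fourth_order (p0 : C -> C) :
  (forall t, U t -> c0 t != 0) ->
  (painleve_field U p0 a0 c0 a1 b2 <->
   [/\ (forall t, U t -> a1 t = - (1 / 2) * derive1n 1 b2 t),
       (forall t, U t ->
          c0 t = t / 2 + 3 / 2 * b2 t ^+ 2 - 1 / 4 * derive1n 2 b2 t),
       (forall t, U t ->
          a0 t = 1 / 4 + 3 / 2 * b2 t * derive1n 1 b2 t - 1 / 8 * derive1n 3 b2 t)
     & fourth_order_eq U p0 b2]).
Proof.
move=> c0N0; split=> [pf|[a1E c0E a0E eq4]].
  have b2' t : U t -> derive1 b2 t = - 2 * a1 t by case/pf.
  have b2'' t : U t -> derive1n 2 b2 t = 6 * b2 t ^+ 2 + 2 * t - 4 * c0 t.
    move=> Ut; have [_ e] := derive1n2_eq oU ha1 b2' Ut.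
    apply: (etrans e); have [_ _ e3 _] := pf t Ut.
    by apply: (etrans (congr1 ( *%R (- 2)) e3)); ring.
  have b2''' t : U t -> derive1n 3 b2 t = 12 * b2 t * derive1 b2 t + 2 - 8 * a0 t.
    move=> Ut; apply: (etrans (derive1n3_eq oU hb2 hc0 b2'' Ut)).
    have [_ e2 _ _] := pf t Ut; congr (_ - _).
    by apply: (etrans (congr1 ( *%R 4) e2)); ring.
  have db2' t : U t -> derivable (derive1 b2) t 1.
    by move=> Ut; have [] := derive1n2_eq oU ha1 b2' Ut.
  split=> t Ut.
  - exact/mulN2_half/b2'.
  - exact/second_derivative_c0E/b2''.
  - exact/third_derivative_a0E/b2'''.
  - apply: (iffLR (fourth_order_elimination (p0 t) (c0N0 t Ut) (b2'' t Ut) (b2''' t Ut)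
      (derive1n4_eq oU hb2 ha0 db2' b2''' Ut))).
    by case: (pf t Ut).
have b2' t : U t -> derive1 b2 t = - 2 * a1 t.
  by move=> Ut; apply/mulN2_half/a1E.
have b2'' t : U t -> derive1n 2 b2 t = 6 * b2 t ^+ 2 + 2 * t - 4 * c0 t.
  by move=> Ut; apply/second_derivative_c0E/c0E.
have b2''' t : U t -> derive1n 3 b2 t = 12 * b2 t * derive1 b2 t + 2 - 8 * a0 t.
  by move=> Ut; apply/third_derivative_a0E/a0E.
have db2' t : U t -> derivable (derive1 b2) t 1.
  by move=> Ut; have [] := derive1n2_eq oU ha1 b2' Ut.
move=> t Ut; split.
- exact: (iffRL (fourth_order_elimination (p0 t) (c0N0 t Ut) (b2'' t Ut) (b2''' t Ut)
      (derive1n4_eq oU hb2 ha0 db2' b2''' Ut)) (eq4 t Ut)).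
(* Two expressions for b2''', one with 4 c0' and one with 8 a0, give c0' = 2 a0. *)
- have e := etrans (esym (derive1n3_eq oU hb2 hc0 b2'' Ut)) (b2''' t Ut).
  move: e; move: (derive1 b2 t) (derive1 c0 t) => db2 dc0 e.
  have h : 4 * (dc0 - 2 * a0 t) = 0.
    by rewrite -[RHS](subrr (12 * b2 t * db2 + 2 - 8 * a0 t)) -{2}e; ring.
  move/eqP: h; rewrite mulf_eq0 pnatr_eq0/= subr_eq0.
  by move/eqP.
(* Likewise, two expressions for b2'' determine a1'. *)
- have [_ e2] := derive1n2_eq oU ha1 b2' Ut.
  have /mulN2_half e1 := etrans (esym (b2'' t Ut)) e2.
  by apply: (etrans e1); field.
- exact: b2'.
Qed.

End Painleve.

(** * Assembly of the equivalences *)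

Theorem mainTheorem4 (R : realType) (U : set (Cplx R))
    (a0 b0 c0 a1 b2 : Cplx R -> Cplx R)
    (oU : open U)
    (ha0 : holo U a0) (hb0 : holo U b0) (hc0 : holo U c0)
    (ha1 : holo U a1) (hb2 : holo U b2) :
  let residue_p0 := fun t => a0 t ^+ 2 + b0 t * c0 t in
  [/\ (* the Lax pair condition *)
      lax_pair U a0 b0 c0 a1 b2 /\ deriv0_on U residue_p0 <->
        isomonodromy_system U a0 b0 c0 a1 b2,
      (* c0 = 0, or a constant residue matrix: the first Painleve equation *)
      forall mu : Cplx R, 2 * mu ^+ 5 = 1 ->
        let reduces_to_P1 :=
          [/\ (forall t, U t -> [/\ a0 t = 0, b0 t = 0 & c0 t = 0]),
              (forall t, U t -> a1 t = - (1 / 2) * derive1 b2 t),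
              (forall t, U t -> derive1n 2 b2 t = 6 * b2 t ^+ 2 + 2 * t)
            & painleve1 [set s | U (mu * s)] (fun s => mu ^+ 2 * b2 (mu * s))]
        in
        (isomonodromy_system U a0 b0 c0 a1 b2 /\ (forall t, U t -> c0 t = 0)
           <-> reduces_to_P1) /\
        (isomonodromy_system U a0 b0 c0 a1 b2 /\
           [/\ deriv0_on U a0, deriv0_on U b0 & deriv0_on U c0]
           <-> reduces_to_P1),
      (* c0 <> 0: elimination of b0 *)
      forall p0 : Cplx R -> Cplx R, holo U p0 -> deriv0_on U p0 ->
        (forall t, U t -> c0 t != 0) ->
        (isomonodromy_system U a0 b0 c0 a1 b2 /\
           (forall t, U t -> p0 t = residue_p0 t)
         <-> painleve_field U p0 a0 c0 a1 b2 /\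
           (forall t, U t -> b0 t = (p0 t - a0 t ^+ 2) / c0 t))
    & (* c0 <> 0: the fourth order equation for b2 *)
      forall p0 : Cplx R -> Cplx R, holo U p0 -> deriv0_on U p0 ->
        (forall t, U t -> c0 t != 0) ->
        (painleve_field U p0 a0 c0 a1 b2 <->
         [/\ (forall t, U t -> a1 t = - (1 / 2) * derive1n 1 b2 t),
             (forall t, U t ->
                c0 t = t / 2 + 3 / 2 * b2 t ^+ 2 - 1 / 4 * derive1n 2 b2 t),
             (forall t, U t ->
                a0 t = 1 / 4 + 3 / 2 * b2 t * derive1n 1 b2 t - 1 / 8 * derive1n 3 b2 t)
           & fourth_order_eq U p0 b2])].
Proof.
split.
- split=> [[lax _]|iso].
    exact/isomonodromy_lax_pair.
  split; first exact/isomonodromy_lax_pair.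
  by move=> t Ut; exact: isomonodromy_residue_det iso Ut.
- by move=> mu mu5; exact: isomonodromy_P1.
- by move=> p0 _ dp0 c0N0; exact: isomonodromy_painleve_field.
- by move=> p0 _ _ c0N0; exact: painleve_field_fourth_order.
Qed.
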